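(* Let $\Delta$ be a pure simplicial complex on vertex set $[n]=\{1,\dots,n\}$ of codimension $c = n-\dim\Delta-1$. If $\Delta$ has at least $\binom{n}{c}-2c+1$ facets, then $\Delta$ is vertex decomposable.
   Context: A simplicial complex on vertex set $[n]$ is assumed to contain $\{i\}$ as a face for every $i\in[n]$. $\Delta$ is pure if all facets (maximal faces) have the same cardinality; $\dim F=|F|-1$ and $\dim\Delta=\max\{\dim F: F\in\Delta\}$. For a vertex $x$, $\mathrm{link}_\Delta(x)=\{G\in\Delta : x\notin G,\ G\cup\{x\}\in\Delta\}$ and $\mathrm{del}_\Delta(x)=\{G\in\Delta: x\notin G\}$. A vertex $x$ is a shedding vertex if for every facet $F$ of $\Delta$ with $x\in F$ there is a vertex $y\notin F$ such that $(F\setminus\{x\})\cup\{y\}\in\Delta$ (equivalently, every facet of $\mathrm{del}_\Delta(x)$ is a facet of $\Delta$). A simplicial complex $\Delta$ is vertex decomposable if either $\Delta=\{\emptyset\}$ or $\Delta$ is a simplex (has a single facet), or there exists a shedding vertex $x$ such that both $\mathrm{link}_\Delta(x)$ and $\mathrm{del}_\Delta(x)$ are vertex decomposable. *)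

(* Defs.v *)
From mathcomp Require Import all_boot all_order all_algebra.

Set Implicit Arguments.
Unset Strict Implicit.
Unset Printing Implicit Defensive.

Section Complexes.
Variable T : finType.
Implicit Types (D : {set {set T}}) (F G : {set T}) (x y : T).

(* The vertices of [D] are the [x] with [[set x] \in D]; they need not exhaust
   [T], so that links and deletions of a complex are complexes on the same
   type. The void complex [set0] is excluded. *)
Definition simplicial_complex D : Prop :=
  set0 \in D /\ forall F G, F \in D -> G \subset F -> G \in D.

Definition complex_on_all_vertices D : Prop :=
  simplicial_complex D /\ forall x, [set x] \in D.

Definition facets D : {set {set T}} := [set F | maxset (fun G => G \in D) F].

Definition pure D : Prop :=
  forall F G, F \in facets D -> G \in facets D -> #|F| = #|G|.

Definition complex_dim D : int := ((\max_(F in D) #|F|)%:Z - 1)%R.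

Definition link D x : {set {set T}} :=
  [set G in D | (x \notin G) && (x |: G \in D)].

Definition del D x : {set {set T}} := [set G in D | x \notin G].

Definition shedding_vertex D x : Prop :=
  [set x] \in D /\
  forall F, F \in facets D -> x \in F ->
    exists y, [/\ [set y] \in D, y \notin F & y |: (F :\ x) \in D].

Inductive vertex_decomposable D : Prop :=
| VD_empty of D = [set set0]
| VD_simplex of #|facets D| = 1
| VD_shedding x of shedding_vertex D x
    & vertex_decomposable (link D x) & vertex_decomposable (del D x).

End Complexes.

(* Main.v *)
Require Import Defs.
From mathcomp Require Import all_boot all_order all_algebra.
From mathcomp Require Import zify.

(** Let [d] be the common size of the facets and call a [d]-subset of the ground
    set [V] missing if it is not a face; the hypothesis says that there are at
    most [2c - 1] missing sets, where [c = #|V| - d].  We induct on [#|V|],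
    allowing points of [V] that are not vertices.  A non-vertex lies in at least
    two missing sets, so it can be dropped from [V] (when [d >= 2]).  The link of
    a vertex keeps [c] and inherits the bound.  The deletion of a shedding vertex
    [x] lowers [c] by one, so it inherits the bound as soon as at most [2c - 3]
    missing sets avoid [x].  A vertex that is not shedding comes with a
    [(d-1)]-set [G] all of whose extensions but one are missing: this gives [c]
    missing sets avoiding [x], and the families of two such vertices share at
    most one set.  Hence for [c >= 3] at most two vertices are not shedding, and
    double counting the pairs (missing set, point outside it) yields a suitable
    shedding vertex. *)

Section MissingFaces.
Set Implicit Arguments.
Unset Strict Implicit.
Variable T : finType.
Implicit Types (D : {set {set T}}) (V F G H : {set T}) (x y z : T) (d c : nat).

(** Purity is expressed by extending faces to size [d], which makes the facets exactly the faces of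
    size [d]. *)
Definition pure_on D V d : Prop :=
  [/\ simplicial_complex D,
      forall F, F \in D -> F \subset V
    & forall F, F \in D -> exists H, [/\ H \in D, F \subset H & #|H| = d]].

Definition missing D V d : {set {set T}} :=
  [set F : {set T} | [&& F \subset V, #|F| == d & F \notin D]].

(** [G] is a facet through [x] with [x] removed, and no other point of [V] can take the place of
    [x]. *)
Definition nonshedding D V d x : bool :=
  [exists G : {set T}, [&& G \subset V, #|G|.+1 == d, x \notin G, x |: G \in D
     & [forall y in V, (y \notin G) ==> (y != x) ==> (y |: G \notin D)]]].

Lemma pure_on_card D V d F : pure_on D V d -> F \in D -> #|F| <= d.
Proof. by case=> _ _ h /h [H [_ sFH <-]]; apply: subset_leq_card. Qed.

Lemma pure_on_facets D V d :
  pure_on D V d -> facets D = [set F in D | #|F| == d].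
Proof.
move=> pD; have [_ _ hD] := pD; apply/setP=> F; rewrite !inE.
apply/maxsetP/andP => [[FD Fmax]|[FD /eqP cF]].
  split=> //; have [H [HD sFH <-]] := hD _ FD.
  by rewrite (Fmax H HD sFH).
split=> // H HD sFH; apply/eqP; rewrite eq_sym eqEcard sFH cF.
exact: pure_on_card pD HD.
Qed.

Lemma pure_on_dim0 D V : pure_on D V 0 -> D = [set set0].
Proof.
move=> pD; have [[D0 _] _ _] := pD; apply/setP=> F; rewrite inE.
apply/idP/eqP=> [FD|-> //].
by apply/eqP; rewrite -cards_eq0 -leqn0; apply: pure_on_card pD FD.
Qed.

Lemma pure_on_codim0 D V : pure_on D V #|V| -> #|facets D| = 1.
Proof.
move=> pD; rewrite (pure_on_facets pD); have [[D0 _] sV hD] := pD.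
have cV F : F \in D -> #|F| = #|V| -> F = V.
  by move=> FD cF; apply/eqP; rewrite eqEcard sV //= cF.
have [H [HD _ cH]] := hD _ D0; apply/eqP/cards1P; exists V.
apply/setP=> F; rewrite !inE; apply/andP/eqP => [[FD /eqP /(cV _ FD)] //|->].
by rewrite -{1}(cV _ HD cH) HD eqxx.
Qed.

(** * Dropped points, links and deletions *)

Lemma pure_on_drop D V d v :
  pure_on D V d -> [set v] \notin D -> pure_on D (V :\ v) d.
Proof.
move=> [cD sV hD] vD; split=> // F FD; apply/subsetP=> y yF.
rewrite !inE (subsetP (sV _ FD)) // andbT; apply: contraNneq vD => <-.
by case: cD => _ /(_ F); apply; rewrite ?sub1set.
Qed.

Lemma pure_on_link D V d x :
  [set x] \in D -> pure_on D V d.+1 -> pure_on (link D x) (V :\ x) d.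
Proof.
move=> xD [[D0 cD] sV hD]; split.
- split; first by rewrite !inE D0 setU0 xD.
  move=> F G; rewrite !inE => /and3P[FD xF xFD] sGF; apply/and3P; split.
  + exact: cD FD sGF.
  + by apply: contra xF; apply: (subsetP sGF).
  + by apply: cD xFD _; rewrite setUS.
- by move=> F; rewrite inE => /and3P[FD xF _]; rewrite subsetD1 sV.
- move=> F; rewrite inE => /and3P[FD xF xFD].
  have [H [HD sxFH cH]] := hD _ xFD.
  have xH : x \in H by apply: (subsetP sxFH); rewrite !inE eqxx.
  exists (H :\ x); split.
  + by rewrite !inE eqxx setD1K // HD andbT (cD H) ?subD1set.
  + by rewrite subsetD1 xF andbT; apply: subset_trans sxFH; apply: subsetUr.
  + by move: cH; rewrite (cardsD1 x) xH => -[].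
Qed.

Lemma not_nonshedding_exchange D V d x F :
    pure_on D V d -> ~~ nonshedding D V d x ->
    F \in D -> #|F| = d -> x \in F ->
  exists y, [/\ y \in V, y \notin F & y |: (F :\ x) \in D].
Proof.
move=> [[_ cD] sV _] /existsPn/(_ (F :\ x)) nx FD cF xF; move: nx.
rewrite (subset_trans (subD1set _ _) (sV _ FD)) setD11 setD1K // FD /=.
rewrite -cF [in _ == #|F|](cardsD1 x F) xF eqxx /=.
rewrite negb_forall => /existsP[y].
rewrite !negb_imply => /and4P[yV nyF yx yD]; exists y; split=> //; last first.
  by move: yD; case: (_ \in D).
by apply: contra nyF => yF; rewrite !inE yx.
Qed.

Lemma not_nonshedding_shedding D V d x :
    pure_on D V d -> (forall y, y \in V -> [set y] \in D) -> x \in V ->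
  ~~ nonshedding D V d x -> shedding_vertex D x.
Proof.
move=> pD allV xV nx; split=> [|F]; first exact: allV.
rewrite (pure_on_facets pD) inE => /andP[FD /eqP cF] xF.
have [y [yV yF yD]] := not_nonshedding_exchange pD nx FD cF xF.
by exists y; split; rewrite ?allV.
Qed.

(** A face avoiding [x] may extend to a facet through [x]; exchanging [x] there gives an extension
    that avoids [x]. *)
Lemma pure_on_del D V d x :
  pure_on D V d -> ~~ nonshedding D V d x -> pure_on (del D x) (V :\ x) d.
Proof.
move=> pD nx; have [[D0 cD] sV hD] := pD; split.
- split; first by rewrite !inE D0.
  move=> F G; rewrite !inE => /andP[FD xF] sGF; rewrite (cD F) //=.
  by apply: contra xF; apply: (subsetP sGF).
- by move=> F; rewrite inE => /andP[FD xF]; rewrite subsetD1 sV.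
- move=> F; rewrite inE => /andP[FD xF].
  have [H [HD sFH cH]] := hD _ FD.
  have [xH|xH] := boolP (x \in H); last by exists H; rewrite inE HD.
  have [y [yV yH yD]] := not_nonshedding_exchange pD nx HD cH xH.
  have yx : x != y by apply: contraNneq yH => <-.
  exists (y |: (H :\ x)); split.
  + by rewrite !inE yD eqxx orbF.
  + by apply: subset_trans (subsetUr _ _); rewrite subsetD1 sFH.
  + rewrite cardsU1 !inE (negbTE yH) andbF /= add1n.
    by move: cH; rewrite (cardsD1 x) xH.
Qed.

(** Adding [x] maps the missing sets of the link injectively to missing sets of [D]. *)
Lemma leq_missing_link D V d x : simplicial_complex D -> x \in V ->
  #|missing (link D x) (V :\ x) d| <= #|missing D V d.+1|.
Proof.
move=> [_ cD] xV.
rewrite -(card_in_imset (f := fun F : {set T} => x |: F)); last first.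
  move=> F G; rewrite !inE => /and3P[]; rewrite subsetD1 => /andP[_ xF] _ _.
  move=> /and3P[]; rewrite subsetD1 => /andP[_ xG] _ _ eFG.
  by rewrite -(setU1K xF) eFG setU1K.
apply: subset_leq_card; apply/subsetP=> _ /imsetP[F + ->].
rewrite !inE => /and3P[]; rewrite subsetD1 => /andP[sFV xF] /eqP cF nF.
rewrite subUset sub1set xV sFV cardsU1 xF cF add1n eqxx /=.
by apply: contra nF => xFD; rewrite xF xFD (cD _ _ xFD) ?subsetUr.
Qed.

(** * Counting the missing sets that avoid a point *)

Definition avoiding D V d x : {set {set T}} :=
  [set F in missing D V d | x \notin F].

Lemma missing_del D V d x :
  missing (del D x) (V :\ x) d = avoiding D V d x.
Proof.
apply/setP=> F; rewrite !inE subsetD1.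
by case: (x \in F); rewrite ?andbT ?andbF.
Qed.

Lemma missing_drop D V d x : missing D (V :\ x) d = avoiding D V d x.
Proof.
apply/setP=> F; rewrite !inE subsetD1.
by case: (x \in F); rewrite ?andbT ?andbF.
Qed.

(** Double counting: each missing set has exactly [c] points of [V] outside it. *)
Lemma sum_avoiding D V d c : #|V| = d + c ->
  \sum_(x in V) #|avoiding D V d x| = #|missing D V d| * c.
Proof.
move=> cV.
transitivity (\sum_(x in V) \sum_(F in missing D V d) (x \notin F : nat)).
  apply: eq_bigr => x _; rewrite -sum1dep_card big_mkcondr /=.
  by apply: eq_bigr => F _; case: (x \notin F).
rewrite exchange_big -sum_nat_const /=; apply: eq_bigr => F.
rewrite inE => /and3P[sFV /eqP cF _].
rewrite -big_mkcondr /= sum1dep_card.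
transitivity #|V :\: F|; first by apply: eq_card => x; rewrite !inE andbC.
by rewrite cardsD (setIidPr sFV) cV cF addKn.
Qed.

(* Exchanging a point of a facet for the non-vertex [v] gives missing sets. *)
Lemma missing_nonvertex D V d v :
    pure_on D V d -> v \in V -> [set v] \notin D ->
  #|avoiding D V d v| + d <= #|missing D V d|.
Proof.
move=> [[D0 cD] sV hD] vV vD; have [F [FD _ cF]] := hD _ D0.
have vF : v \notin F.
  by apply: contra vD => vF; apply: cD FD _; rewrite sub1set.
pose N := [set v |: (F :\ a) | a in F].
have cN : #|N| = d.
  rewrite -cF; apply: card_in_imset => a b aF bF eab; apply/eqP.
  have : b \notin v |: (F :\ a).
    by rewrite eab !inE eqxx orbF; apply: contraNneq vF => <-.
  by rewrite !inE bF andbT negb_or negbK => /andP[_ /eqP ->].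
have dN : [disjoint avoiding D V d v & N].
  rewrite -setI_eq0; apply/eqP/setP=> H; rewrite !inE.
  apply/negP=> /andP[/andP[_ vH] /imsetP[a _ eH]].
  by move: vH; rewrite eH !inE eqxx.
have <- : #|avoiding D V d v :|: N| = #|avoiding D V d v| + d.
  by apply/eqP; rewrite -[in X in _ == _ + X]cN (leq_card_setU _ _).2.
apply: subset_leq_card; apply/subsetP=> H; rewrite inE => /orP[].
  by rewrite inE => /andP[].
case/imsetP=> a aF ->; rewrite inE subUset sub1set vV /=.
rewrite (subset_trans (subD1set _ _) (sV _ FD)) /=.
rewrite cardsU1 !inE (negbTE vF) andbF /=.
apply/andP; split; first by rewrite -cF (cardsD1 a F) aF.
by apply: contra vD => /cD; apply; rewrite sub1set !inE eqxx.
Qed.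

(** * Fans of missing sets and the choice of a shedding vertex *)

Definition fan V G x : {set {set T}} := [set y |: G | y in V :\: (x |: G)].

(** A common member contains [G :|: H], which has more than [#|G|] points since [G] and [H] are
    distinct of equal size; hence it equals [G :|: H]. *)
Lemma fan_meet V G H x y :
  #|G| = #|H| -> G != H -> #|fan V G x :&: fan V H y| <= 1.
Proof.
move=> eGH nGH; rewrite -(cards1 (G :|: H)); apply: subset_leq_card.
apply/subsetP=> _ /setIP[/imsetP[a /setDP[_ aG] ->] /imsetP[b _ eab]].
have {}aG : a \notin G by apply: contra aG; rewrite !inE => ->; rewrite orbT.
rewrite inE eq_sym eqEcard subUset subsetUr {1}eab subsetUr /= cardsU1 aG.
rewrite add1n ltnNge; apply: contra nGH => le.
have /eqP eG : G == G :|: H by rewrite eqEcard subsetUl.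
by rewrite eq_sym eqEcard eGH leqnn andbT eG subsetUr.
Qed.

Lemma nonshedding_fan D V d c x :
    pure_on D V d -> #|V| = d + c -> nonshedding D V d x ->
  exists G, [/\ #|G|.+1 = d, x \notin G, x |: G \in D, #|fan V G x| = c
     & fan V G x \subset avoiding D V d x].
Proof.
move=> [_ sV _] cV /existsP[G /and5P[sGV /eqP cG xG xGD /'forall_implyP hG]].
exists G; split=> //.
  rewrite card_in_imset => [|y z /setDP[_ yG] _ eyz].
    by rewrite cardsD (setIidPr (sV _ xGD)) cardsU1 xG add1n cG cV addKn.
  have : y \in z |: G by rewrite -eyz !inE eqxx.
  move: yG; rewrite !inE negb_or => /andP[_ /negbTE ->].
  by rewrite orbF => /eqP.
apply/subsetP=> _ /imsetP[y /setDP[yV +] ->].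
rewrite !inE negb_or => /andP[yx yG].
rewrite subUset sub1set yV sGV cardsU1 yG add1n cG eqxx negb_or xG andbT /=.
by rewrite eq_sym yx andbT; move: (hG _ yV); rewrite yG yx /= andbT.
Qed.

(** Three fans of [c] sets, pairwise sharing at most one set, cover at least [3 * c - 3] missing
    sets. *)
Lemma nonshedding_card D V d c :
    pure_on D V d -> #|V| = d + c -> #|missing D V d| + 3 < 3 * c ->
  #|[set x in V | nonshedding D V d x]| <= 2.
Proof.
move=> pD cV cM; rewrite leqNgt; apply/negP=> /card_gt2P.
case=> x [y [z [[]]]]; rewrite !inE => /andP[_ nx] /andP[_ ny] /andP[_ nz].
case=> xy yz zx.
have [G [cG xG xGD cfG sfG]] := nonshedding_fan pD cV nx.
have [H [cH yH yHD cfH sfH]] := nonshedding_fan pD cV ny.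
have [K [cK zK zKD cfK sfK]] := nonshedding_fan pD cV nz.
have sM w : avoiding D V d w \subset missing D V d.
  by apply/subsetP=> F; rewrite inE => /andP[].
(* If [A = B], the face [b |: B] would belong to the fan at [a] and so be missing. *)
have neq (a b : T) (A B : {set T}) : fan V A a \subset avoiding D V d a ->
    b \notin B -> b |: B \in D -> a != b -> A != B.
  move=> sA bB bBD ab; apply/eqP=> eAB; move: sA; rewrite {}eAB.
  have bV : b \in V.
    by have [_ sV _] := pD; apply: (subsetP (sV _ bBD)); rewrite !inE eqxx.
  have /[swap]/subsetP/[apply] : b |: B \in fan V B a.
    by apply: imset_f; rewrite !inE negb_or eq_sym ab bB.
  by rewrite !inE bBD !andbF.
have cGH : #|G| = #|H| by apply: succn_inj; rewrite cG cH.
have cHK : #|H| = #|K| by apply: succn_inj; rewrite cH cK.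
have mGH := fan_meet V x y cGH (neq _ _ _ _ sfG yH yHD xy).
have mHK := fan_meet V y z cHK (neq _ _ _ _ sfH zK zKD yz).
have mKG := fan_meet V z x (esym (etrans cGH cHK)) (neq _ _ _ _ sfK xG xGD zx).
have := cardsUI (fan V G x) (fan V H y).
have := cardsUI (fan V G x :|: fan V H y) (fan V K z).
have : #|fan V G x :|: fan V H y :|: fan V K z| <= #|missing D V d|.
  apply: subset_leq_card; rewrite !subUset (subset_trans sfG) //.
  by rewrite (subset_trans sfH) // (subset_trans sfK).
have : #|(fan V G x :|: fan V H y) :&: fan V K z| <= 2.
  rewrite setIUl [fan V G x :&: _]setIC.
  apply: leq_trans (leq_add mKG mHK); rewrite -cardsUI.
  exact: leq_addr.
by rewrite cfG cfH cfK; move: cM mGH; clear; lia.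
Qed.

Lemma exists_shedding D V d c :
    pure_on D V d -> #|V| = d + c -> 0 < c -> 1 < d ->
    #|missing D V d| <= (2 * c).-1 ->
  exists x, [/\ x \in V, ~~ nonshedding D V d x
     & #|avoiding D V d x| <= (2 * c.-1).-1].
Proof.
move=> pD cV c0 d1 cM.
pose B := [set x in V | nonshedding D V d x].
have avB x : x \in B -> c <= #|avoiding D V d x|.
  rewrite inE => /andP[_ /(nonshedding_fan pD cV)[G [_ _ _ <- sG]]].
  exact: subset_leq_card.
have [/existsP[x /and3P[xV xn xa]]|no] :=
  boolP [exists x, [&& x \in V, ~~ nonshedding D V d x
                     & #|avoiding D V d x| <= (2 * c.-1).-1]].
  by exists x.
have {}no x : x \in V :\: B -> (2 * c.-1).-1 < #|avoiding D V d x|.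
  rewrite !inE => /andP[+ xV]; rewrite xV /= => xn.
  by move/existsPn: no => /(_ x); rewrite xV xn /= -ltnNge.
have sBV : B \subset V by apply/subsetP=> x; rewrite inE => /andP[].
have le1 : #|B| * c <= \sum_(x in B) #|avoiding D V d x|.
  by rewrite -sum_nat_const; apply: leq_sum.
have le2 : (#|V| - #|B|) * (2 * c.-1).-1.+1
           <= \sum_(x in V :\: B) #|avoiding D V d x|.
  rewrite -{1}(setIidPr sBV) -cardsD -sum_nat_const; exact: leq_sum.
have := sum_avoiding D cV; rewrite (big_setID B) /= (setIidPr sBV) => eM.
(* The inequality [(2 * c - 1) + 3 < 3 * c] holds exactly from [c = 3] on. *)
have cB3 : 2 < c -> #|B| <= 2.
  by move=> c2; apply: (nonshedding_card pD cV); move: cM c2; clear; lia.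
have := subset_leq_card sBV; move: le1 le2 eM cB3 cM; rewrite cV.
move: #|B| (\sum_(x in B) _) (\sum_(x in _ :\: _) _).
move: #|missing D V d|.
move: c0 d1; clear => c0 d1 m b s1 s2 le1 le2 eM cB3 cM leb.
(* For [c <= 2] the value [(2 * c.-1).-1.+1] is [c], so the sum is at least [(d + c) * c], which
   exceeds [(2 * c - 1) * c] because [d > 1]. *)
have [c2|c2] := leqP c 2.
  by have [e|e] : c = 1 \/ c = 2 by [lia]; rewrite e in le1 le2 eM cM leb; lia.
have b2 := cB3 c2; have := leq_mul cM (leqnn c); rewrite -{}eM.
have {}le2 : (c + (2 - b)) * (2 * c.-1).-1.+1 <= s2.
  by apply: leq_trans le2; apply: leq_mul => //; lia.
(* This substitution removes the truncated subtractions; each value of [b] then leaves an inequality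
   between quadratics in [k]. *)
have [k ec] : exists k, c = k + 3 by exists (c - 3); lia.
move: le1 le2; rewrite {}ec.
have -> : (2 * (k + 3).-1).-1.+1 = 2 * k + 4 by lia.
have -> : (2 * (k + 3)).-1 = 2 * k + 5 by lia.
have [->|[->|->]] : b = 0 \/ b = 1 \/ b = 2 by [lia].
all: clear; lia.
Qed.

(** * The induction on the ground set *)

(* For [c = 0] the truncated [(2 * c).-1] is [0]. *)
Lemma pure_on_vertex_decomposable D V d c :
    pure_on D V d -> #|V| = d + c ->
    d <= 1 \/ #|missing D V d| <= (2 * c).-1 ->
  vertex_decomposable D.
Proof.
have [n] := ubnP #|V|; elim: n V D d c => // n IHn V D d c ltVn pD cV hM.
have [d0|d0] := posnP d.
  by apply: VD_empty; rewrite d0 in pD; apply: pure_on_dim0 pD.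
have [c0|c0] := posnP c.
  by apply: VD_simplex; apply: (@pure_on_codim0 D V); rewrite cV c0 addn0.
have cV1 x : x \in V -> #|V :\ x| = #|V|.-1.
  by move=> xV; rewrite (cardsD1 x V) xV.
have [/existsP[v /andP[vV vD]]|allV] :=
  boolP [exists v, (v \in V) && ([set v] \notin D)].
  apply: (IHn (V :\ v) D d c.-1); rewrite ?cV1 //; try lia.
    exact: pure_on_drop.
  (* For [d >= 2] the loss of at least [d] missing sets makes up for the bound, which falls by at
     most 2; for [d = 1] the first alternative carries over. *)
  have := missing_nonvertex pD vV vD; rewrite missing_drop; lia.
have {}allV x : x \in V -> [set x] \in D.
  by move=> xV; move/existsPn: allV => /(_ x); rewrite xV /= negbK.
have [x [xV nx hx]] : exists x, [/\ x \in V, ~~ nonshedding D V d x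
    & d <= 1 \/ #|avoiding D V d x| <= (2 * c.-1).-1].
  have [d1|d1] := leqP d 1; last first.
    case: hM => [|hM]; first by rewrite leqNgt d1.
    have [x [xV nx hx]] := exists_shedding pD cV c0 d1 hM.
    by exists x; split; auto.
  (* Here a failed exchange would have [G] empty, but any second point of [V] is a vertex and can
     replace [x]. *)
  have d_eq1 : d = 1 by lia.
  have /card_gt1P[x [y [xV yV xy]]] : 1 < #|V| by lia.
  exists x; split; auto; apply/existsPn=> G; apply/negP=> /and5P[_ + _ _].
  rewrite d_eq1 eqSS cards_eq0 => /eqP-> /'forall_implyP/(_ y yV).
  by rewrite in_set0 eq_sym xy setU0 allV.
apply: (@VD_shedding _ _ x).
- exact: not_nonshedding_shedding pD allV xV nx.
- case: d d0 pD cV hM {nx hx} => // d _ pD cV hM.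
  apply: (IHn (V :\ x) _ d c); rewrite ?cV1 //; try lia.
    by apply: pure_on_link => //; apply: allV.
  have [cD _ _] := pD; have := leq_missing_link d cD xV; lia.
- apply: (IHn (V :\ x) _ d c.-1); rewrite ?cV1 //; try lia.
    exact: pure_on_del.
  by rewrite missing_del.
Qed.

(** * From the number of facets to the number of missing sets *)

Lemma pure_pure_on D :
  simplicial_complex D -> pure D -> pure_on D setT (\max_(F in D) #|F|).
Proof.
move=> [D0 cD] pD; split=> // F FD.
have [H maxH sFH] := maxset_exists (P := fun G => G \in D) FD.
have HD := maxsetp maxH; exists H; split=> //.
apply/eqP; rewrite eqn_leq; apply/andP; split; first exact: leq_bigmax_cond.
apply/bigmax_leqP=> K KD.
have [L maxL sKL] := maxset_exists (P := fun G => G \in D) KD.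
rewrite (pD H L) ?inE //; exact: subset_leq_card.
Qed.

(** A [d]-subset is either a face, and then a facet, or missing. *)
Lemma card_facets_missing D d : pure_on D setT d ->
  #|facets D| + #|missing D setT d| = 'C(#|T|, d).
Proof.
move=> pD; rewrite (pure_on_facets pD) -card_draws -[RHS](cardsID D).
congr (_ + _); apply: eq_card => F; rewrite !inE ?subsetT //= andbC //.
Qed.

End MissingFaces.

Theorem theorem1p1 (n c : nat) (D : {set {set 'I_n}})
  (D_complex : complex_on_all_vertices D)
  (D_pure : pure D)
  (c_codim : (c%:Z = n%:Z - complex_dim D - 1)%R)
  (D_facets : ('C(n, c)%:Z - 2 * c%:Z + 1 <= #|facets D|%:Z)%R) :
  vertex_decomposable D.
Proof.
have [cD _] := D_complex; have pD := pure_pure_on cD D_pure.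
move: pD c_codim; rewrite /complex_dim; set d := \max_(F in D) #|F|.
move=> pD c_codim; have n_eq : n = d + c by lia.
have cT : #|[set: 'I_n]| = d + c by rewrite cardsT card_ord.
apply: (pure_on_vertex_decomposable pD cT); right.
have := card_facets_missing pD; rewrite card_ord.
have -> : 'C(n, d) = 'C(n, c) by rewrite -bin_sub n_eq ?leq_addr ?addKn.
(* For [c = 0] the hypothesis asks for two facets while the count allows only one, so the truncation
   in [(2 * c).-1] is harmless. *)
lia.
Qed.
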